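(* Let $\mathcal{G}=(\mathcal{V},\mathcal{E},\mathcal{A})$ be an undirected weighted graph on $\mathcal{V}=\{1,\ldots,N\}$, $N\ge 2$, with symmetric weighted adjacency matrix $\mathcal{A}=[a_{ij}]\in\mathbb{R}^{N\times N}$ and no self-loops, and assume $\mathcal{G}$ is connected. Let $a$ be a real number with $-1<a<1$ and $a\neq 0$. Consider the multi-agent system of $N$ identical discrete-time neutrally stable systems with input saturation $$\begin{bmatrix} x_i(k+1)\\ v_i(k+1)\end{bmatrix}=\begin{bmatrix}0&1\\-1&2a\end{bmatrix}\begin{bmatrix}x_i(k)\\ v_i(k)\end{bmatrix}+\begin{bmatrix}0\\1\end{bmatrix}\sigma(u_i(k)),\qquad i\in\mathcal{V},\ k=0,1,2,\ldots,$$ under the distributed controller $$u_i(k)=\alpha\sum_{j\in\mathcal{N}_i}a_{ij}\bigl(x_j(k)-x_i(k)\bigr)+\beta\sum_{j\in\mathcal{N}_i}a_{ij}\bigl(v_j(k)-v_i(k)\bigr),\qquad i\in\mathcal{V},$$ with real feedback gain parameters $\alpha,\beta$. Let $$S_e=\{i\in\mathcal{V}\mid d(i,1)\text{ is even}\},\qquad S_o=\{i\in\mathcal{V}\mid d(i,1)\text{ is odd}\},\qquad \bar a=\min_{\substack{(i,j)\in\mathcal{E}\\ i\in S_e,\ j\in S_o}}a_{ij}.$$ If $$|\alpha|\le \operatorname{sign}(a)\Bigl(\beta-\frac{a}{\bar a}\Bigr),$$ then the multi-agent system exhibits a periodic solution with period $T=4$.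
   Context: Graph conventions: $a_{ij}>0$ if and only if $(j,i)\in\mathcal{E}$, and $a_{ij}=0$ otherwise; $a_{ij}=a_{ji}$ for all $i,j\in\mathcal{V}$ and $a_{ii}=0$ for all $i\in\mathcal{V}$. The set of neighbors of agent $i$ is $\mathcal{N}_i=\{j\in\mathcal{V}\mid a_{ij}>0\}$. The graph is connected if there is a path between any pair of distinct nodes. The unweighted distance $d(i,j)$ is the minimal number of edges of a path between $i$ and $j$ (so $d(1,1)=0$). Agent $1$ serves as the root agent. Each agent $i$ has scalar real states $x_i(k),v_i(k)$ and scalar input $u_i(k)$. The function $\sigma$ is the standard saturation function $\sigma(u)=\operatorname{sign}(u)\min\{1,|u|\}$. Definition (periodic solution): the closed-loop multi-agent system exhibits a periodic solution with a period $T>0$ ($T$ an integer) if for some initial states $x_i(0)$ and $v_i(0)$, $i\in\mathcal{V}$, one has $x_i(k+T)=x_i(k)$ and $v_i(k+T)=v_i(k)$ for all non-negative integers $k$ and all $i\in\mathcal{V}$. *)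

(* Defs.v *)
From mathcomp Require Import all_boot all_order all_algebra.
From mathcomp Require Import reals.

Set Implicit Arguments.
Unset Strict Implicit.
Unset Printing Implicit Defensive.

Import Order.TTheory GRing.Theory Num.Theory.
Local Open Scope ring_scope.

Record wgraph (R : realType) (N : nat) := WGraph {
  edge : rel 'I_N;
  weight : 'M[R]_N;
  weight_edge : forall i j, (0 < weight i j) = edge j i;
  weight_nonedge : forall i j, ~~ edge j i -> weight i j = 0;
  weight_sym : forall i j, weight i j = weight j i;
  weight_diag : forall i, weight i i = 0
}.

Definition neighbors (R : realType) (N : nat) (G : wgraph R N) (i : 'I_N) :
  {set 'I_N} := [set j | 0 < weight G i j].

Definition connected (R : realType) (N : nat) (G : wgraph R N) : Prop :=
  forall i j : 'I_N, i != j -> connect (edge G) i j.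

Definition has_walk (R : realType) (N : nat) (G : wgraph R N) (i j : 'I_N)
    (n : nat) : bool :=
  [exists p : n.-tuple 'I_N, path (edge G) i p && (last i p == j)].

Lemma connected_has_walk (R : realType) (N : nat) (G : wgraph R N)
    (hG : connected G) (i j : 'I_N) : exists n, has_walk G i j n.
Proof.
have /connectP[p ep ->] : connect (edge G) i j.
  by have [->|/hG] := eqVneq i j; first exact: connect0.
by exists (size p); apply/existsP; exists (in_tuple p); rewrite ep eqxx.
Qed.

Definition dist (R : realType) (N : nat) (G : wgraph R N) (hG : connected G)
  (i j : 'I_N) : nat := ex_minn (connected_has_walk hG i j).

Definition even_agents (R : realType) (N : nat) (G : wgraph R N)
  (hG : connected G) (root : 'I_N) : {set 'I_N} :=
  [set i | ~~ odd (dist hG i root)].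

Definition odd_agents (R : realType) (N : nat) (G : wgraph R N)
  (hG : connected G) (root : 'I_N) : {set 'I_N} :=
  [set i | odd (dist hG i root)].

Definition cross_edge (R : realType) (N : nat) (G : wgraph R N)
    (hG : connected G) (root : 'I_N) (e : 'I_N * 'I_N) : bool :=
  [&& edge G e.1 e.2, e.1 \in even_agents hG root
    & e.2 \in odd_agents hG root].

Lemma cross_edge_ex (R : realType) (N : nat) (G : wgraph R N)
    (hG : connected G) (root : 'I_N) :
  (1 < N)%N -> exists e, cross_edge hG root e.
Proof.
move=> N1.
have distP i n : has_walk G i root n -> (dist hG i root <= n)%N.
  by rewrite /dist; case: ex_minnP => m _ mn /mn.
have dist0 : dist hG root root = 0%N.
  apply/eqP; rewrite -leqn0; apply: distP; apply/existsP.
  by exists [tuple]; rewrite /= eqxx.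
have [j jr] : exists j : 'I_N, j != root.
  pose i0 := Ordinal (ltnW N1); pose i1 := Ordinal N1.
  have [i0r|] := eqVneq i0 root; last by exists i0.
  by exists i1; rewrite -i0r.
have symE i k : edge G i k = edge G k i by rewrite -!weight_edge weight_sym.
have [k rk] : exists k, edge G root k.
  have /connectP[[|k p] /=] : connect (edge G) root j by apply: (hG root j); rewrite eq_sym.
    by move=> _ jE; rewrite jE eqxx in jr.
  by case/andP=> rk _ _; exists k.
have kr : k != root.
  apply/eqP => kr; move: rk; rewrite kr -weight_edge weight_diag.
  by rewrite ltxx.
have dk1 : (dist hG k root <= 1)%N.
  apply: distP; apply/existsP; exists [tuple root] => /=.
  by rewrite symE rk eqxx.
have dk0 : dist hG k root != 0%N.
  rewrite /dist; case: ex_minnP => -[|m] //= /existsP[p].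
  by rewrite tuple0 /= => /eqP kE; rewrite kE eqxx in kr.
exists (root, k); rewrite /cross_edge /= rk !inE dist0 /=.
by move: dk1 dk0; case: (dist hG k root) => [|[|]].
Qed.

(* The value 0 is a placeholder for an empty set of cross edges, which cannot
   occur in a connected graph with at least two nodes (see cross_edge_ex). *)
Definition min_cross_weight (R : realType) (N : nat) (G : wgraph R N)
    (hG : connected G) (root : 'I_N) : R :=
  if [pick e | cross_edge hG root e] is Some e0 then
    let e := [arg min_(e < e0 | cross_edge hG root e) weight G e.1 e.2]%O in
    weight G e.1 e.2
  else 0.

Definition sat (R : realType) (u : R) : R := Num.sg u * Num.min 1 `|u|.

Definition control (R : realType) (N : nat) (G : wgraph R N) (alpha beta : R)
    (x v : 'I_N -> nat -> R) (i : 'I_N) (k : nat) : R :=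
  alpha * (\sum_(j in neighbors G i) weight G i j * (x j k - x i k)) +
  beta * (\sum_(j in neighbors G i) weight G i j * (v j k - v i k)).

Definition closed_loop (R : realType) (N : nat) (G : wgraph R N)
    (a alpha beta : R) (x v : 'I_N -> nat -> R) : Prop :=
  forall (i : 'I_N) (k : nat),
    x i k.+1 = v i k /\
    v i k.+1 = - x i k + 2 * a * v i k + sat (control G alpha beta x v i k).

Definition has_period (R : realType) (N : nat) (x v : 'I_N -> nat -> R)
    (T : nat) : Prop :=
  forall (k : nat) (i : 'I_N), x i (k + T)%N = x i k /\ v i (k + T)%N = v i k.

(* A trajectory of the closed loop is determined by its initial states, so
   quantifying over trajectories is quantifying over initial states.  The last
   clause makes T the least period; without it the equilibrium x = v = 0 would
   be a periodic solution of every period. *)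
Definition exhibits_periodic_solution (R : realType) (N : nat)
    (G : wgraph R N) (a alpha beta : R) (T : nat) : Prop :=
  (0 < T)%N /\
  exists x v : 'I_N -> nat -> R,
    [/\ closed_loop G a alpha beta x v,
        has_period x v T
      & forall T' : nat, (0 < T' < T)%N -> ~ has_period x v T'].

(* Main.v *)
(* Put every agent on the orbit p, p, -p, -p, ... with p = 1/(2a) when the
   distance to the root is even and p = -1/(2a) when it is odd.  Since
   x(k+2) = -x(k), such a trajectory solves the system as soon as the saturated
   input equals -2a v(k), which is +1 or -1.  Agents of equal parity agree, so
   the input is -2 W (alpha x + beta v), where W is the total weight towards the
   neighbors of opposite parity.  Every agent has such a neighbor, hence W is at
   least the minimal cross weight, and the gain condition forces saturation. *)
Require Import Defs.
From mathcomp Require Import all_boot all_order all_algebra.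
From mathcomp Require Import reals.
From mathcomp Require Import ring lra.
Import Order.TTheory GRing.Theory Num.Theory.
Local Open Scope ring_scope.

Lemma sat_sign (R : realType) (b : bool) (t : R) :
  1 <= t -> sat ((-1) ^+ b * t) = (-1) ^+ b.
Proof.
move=> t1; have t0 : 0 < t := lt_le_trans ltr01 t1.
by rewrite /sat sgrM (gtr0_sg t0) normrM normr_sign mul1r (gtr0_norm t0) min_l //
           !mulr1; case: b; rewrite ?expr0 ?expr1 ?sgrN sgr1.
Qed.

Lemma edge_sym (R : realType) (N : nat) (G : wgraph R N) : symmetric (edge G).
Proof. by move=> i j; rewrite -!weight_edge weight_sym. Qed.

Lemma edge_irrefl (R : realType) (N : nat) (G : wgraph R N) :
  irreflexive (edge G).
Proof. by move=> i; rewrite -weight_edge weight_diag ltxx. Qed.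

Section Distance.
Variables (R : realType) (N : nat) (G : wgraph R N) (hG : connected G).
Implicit Types i j k root : 'I_N.

Lemma has_walkP i j n :
  reflect (exists p, [/\ size p = n, path (edge G) i p & last i p = j])
          (has_walk G i j n).
Proof.
apply: (iffP existsP) => [[p /andP[ip /eqP pj]]|[p [<- ip pj]]].
  by exists p; rewrite size_tuple.
by exists (in_tuple p); rewrite ip pj eqxx.
Qed.

Lemma has_walk_dist i j : has_walk G i j (dist hG i j).
Proof. by rewrite /dist; case: ex_minnP. Qed.

Lemma dist_le i j n : has_walk G i j n -> (dist hG i j <= n)%N.
Proof. by rewrite /dist; case: ex_minnP => m _ mn /mn. Qed.

Lemma distxx i : dist hG i i = 0%N.
Proof. by apply/eqP; rewrite -leqn0; apply/dist_le/has_walkP; exists [::]. Qed.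

Lemma dist_eq0 i j : (dist hG i j == 0%N) = (i == j).
Proof.
apply/eqP/eqP => [d0|->]; last exact: distxx.
by have := has_walk_dist i j; rewrite d0 => /has_walkP[p [/size0nil-> _ <-]].
Qed.

Lemma dist_edge i j k : edge G i j -> (dist hG i k <= (dist hG j k).+1)%N.
Proof.
move=> ij; have /has_walkP[p [ps jp pk]] := has_walk_dist j k.
by apply/dist_le/has_walkP; exists (j :: p); rewrite /= ps ij.
Qed.

(** The first step of a shortest walk leaves a shortest walk behind, since [dist_edge] bars a drop
    by more than one. *)
Lemma dist_pred i j : i != j ->
  exists2 k, edge G i k & dist hG i j = (dist hG k j).+1.
Proof.
move=> ij; have /has_walkP[[|k p] [/= ps ip pj]] := has_walk_dist i j.
  by rewrite pj eqxx in ij.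
case/andP: ip => ik kp; exists k => //; apply/eqP.
rewrite eqn_leq dist_edge //= -ps ltnS.
by apply/dist_le/has_walkP; exists p.
Qed.

(** Away from the root, a step along a shortest walk to it flips the parity. At the root, every
    neighbor is at distance exactly 1. *)
Lemma opposite_parity_neighbor root i : (1 < N)%N ->
  exists2 j, edge G i j & odd (dist hG i root) != odd (dist hG j root).
Proof.
move=> N1; have [->|/dist_pred[j ij ->]] := eqVneq i root; last first.
  by exists j => //=; case: odd.
have [j jr] : exists j, root != j.
  apply/existsP; rewrite -negb_forall; apply/forallP => allr.
  have := eqP (allr (Ordinal N1)); rewrite (eqP (allr (Ordinal (ltnW N1)))).
  by move/(congr1 val).
(* The walk towards [j] only serves to give the root a neighbor. *)
have [k rk _] := dist_pred root j jr; exists k => //.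
have := dist_edge k root root; rewrite edge_sym distxx => /(_ rk).
have : dist hG k root != 0%N.
  by rewrite dist_eq0; apply: contraTneq rk => ->; rewrite edge_irrefl.
by case: (dist hG k root) => [|[|]].
Qed.

Lemma min_cross_weightP root : (1 < N)%N ->
  exists2 e, cross_edge hG root e &
    min_cross_weight hG root = weight G e.1 e.2 /\
    forall e', cross_edge hG root e' -> weight G e.1 e.2 <= weight G e'.1 e'.2.
Proof.
move=> N1; rewrite /min_cross_weight; case: pickP => [e0 ce0|no_cross].
  by case: arg_minP => // e ce emin; exists e.
by have [e] := cross_edge_ex hG root N1; rewrite no_cross.
Qed.

Lemma min_cross_weight_gt0 root : (1 < N)%N -> 0 < min_cross_weight hG root.
Proof.
move=> /min_cross_weightP-/(_ root)[e /and3P[ee _ _] [-> _]].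
by rewrite weight_edge edge_sym.
Qed.

(** Cross edges run from even to odd, so an edge from odd to even is reversed by symmetry of the
    weights. *)
Lemma min_cross_weight_le root i j : (1 < N)%N -> edge G i j ->
  odd (dist hG i root) != odd (dist hG j root) ->
  min_cross_weight hG root <= weight G i j.
Proof.
move=> /min_cross_weightP-/(_ root)[e _ [-> emin]] ij.
case oi: (odd (dist hG i root)); case oj: (odd (dist hG j root)) => // _.
  rewrite (weight_sym G i j); apply: (emin (j, i)).
  by rewrite /cross_edge /= edge_sym ij !inE oi oj.
by apply: (emin (i, j)); rewrite /cross_edge /= ij !inE oi oj.
Qed.

(** The total weight W that multiplies the input of agent [i]. *)
Definition cross_degree root i : R :=
  \sum_(j in neighbors G i | odd (dist hG i root) != odd (dist hG j root))
     weight G i j.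

Lemma min_cross_weight_le_degree root i : (1 < N)%N ->
  min_cross_weight hG root <= cross_degree root i.
Proof.
move=> N1; have [j ij oij] := opposite_parity_neighbor root i N1.
rewrite /cross_degree (bigD1 j) /=; last first.
  by rewrite inE weight_edge edge_sym ij.
apply: ler_wpDr; last exact: min_cross_weight_le.
by apply: sumr_ge0 => k /andP[/andP[]]; rewrite inE => /ltW.
Qed.

(** Terms of equal parity vanish, and each other term is -2 times the agent's own value. The bit [b]
    carries the sign at a given time, so that one statement serves both x and v. *)
Lemma sum_parity_diff root i (c : R) (b : bool) :
  \sum_(j in neighbors G i) weight G i j *
     ((-1) ^+ (odd (dist hG j root) (+) b) * c -
      (-1) ^+ (odd (dist hG i root) (+) b) * c) =
  - 2 * cross_degree root i * ((-1) ^+ (odd (dist hG i root) (+) b) * c).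
Proof.
rewrite /cross_degree mulr_sumr mulr_suml [RHS]big_mkcondr /=.
apply: eq_bigr => j _.
by case: (odd (dist hG i root)); case: (odd (dist hG j root)); case: b => /=;
  rewrite ?expr0 ?expr1; ring.
Qed.

End Distance.

(** Since 1/a = sg(a)/|a|, it suffices that w sg(a)(beta ± alpha) is at least |a|. The gain
    condition bounds sg(a)(beta ± alpha) below by |a|/m, and w is at least m. *)
Lemma gain_saturates (R : realType) (a alpha beta m w : R) (b : bool) :
  a != 0 -> 0 < m -> m <= w -> `|alpha| <= Num.sg a * (beta - a / m) ->
  1 <= w * (beta + (-1) ^+ b * alpha) / a.
Proof.
move=> a0 m0 mw hgain.
have na0 : 0 < `|a| by rewrite normr_gt0.
have -> : w * (beta + (-1) ^+ b * alpha) / a =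
    w * (Num.sg a * (beta + (-1) ^+ b * alpha)) / `|a|.
  case: (sgrP a) => [a_0|_|_]; first by rewrite a_0 eqxx in a0.
    by rewrite mul1r.
  by field.
rewrite ler_pdivlMr // mul1r.
have bnd : `|a| / m <= Num.sg a * (beta + (-1) ^+ b * alpha).
  have : - (Num.sg a * ((-1) ^+ b * alpha)) <= `|alpha|.
    apply: le_trans (ler_norm _) _.
    by rewrite normrN !normrM normr_sign normr_sg a0 !mul1r.
  move: hgain; rewrite mulrBr mulrDr mulrA -normrEsg; lra.
apply: le_trans (_ : w * (`|a| / m) <= _); last first.
  by rewrite ler_wpM2l // (le_trans (ltW m0)).
by rewrite mulrCA ler_peMr ?(ltW na0) // ler_pdivlMr // mul1r.
Qed.

Theorem theorem2 (R : realType) (N : nat) (hN : (1 < N)%N)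
    (G : wgraph R N) (hG : connected G)
    (a : R) (ha1 : -1 < a) (ha2 : a < 1) (ha0 : a != 0)
    (alpha beta : R)
    (hgain : `|alpha| <=
      Num.sg a * (beta - a / min_cross_weight hG (Ordinal (ltnW hN)))) :
  exhibits_periodic_solution G a alpha beta 4.
Proof.
split=> //; set root := Ordinal (ltnW hN) in hgain *.
(* The parity of [k./2] produces the time pattern +, +, -, -. *)
pose x i k := (-1) ^+ (odd (dist hG i root) (+) odd k./2) * (2 * a)^-1 : R.
have xSS i k : x i k.+2 = - x i k.
  by rewrite /x /= addbN -mulNr; case: (_ (+) _); rewrite ?opprK.
have x_neq i k : - x i k <> x i k.
  move/eqP; rewrite eqNr mulf_eq0.
  by rewrite signr_eq0 /= invr_eq0 mulf_eq0 pnatr_eq0 (negPf ha0).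
exists x, (fun i k => x i k.+1); split.
- move=> i k; split=> //; rewrite xSS -addrA -[LHS]addr0; congr (_ + _).
  rewrite /control !sum_parity_diff.
  set W := cross_degree _ _ _ _ _ _; set d := odd (dist hG i root).
  (* Factoring the sign of -v(k) out of the input leaves [t]. The sign before [alpha] is that of
     x(k)v(k), which alternates with k, so both signs must saturate. *)
  pose t := W * (beta + (-1) ^+ (odd k./2 (+) odd k.+1./2) * alpha) / a.
  have t1 : 1 <= t.
    apply: gain_saturates hgain => //; first exact: min_cross_weight_gt0.
    exact: min_cross_weight_le_degree.
  have -> : alpha * (- 2 * W * ((-1) ^+ (d (+) odd k./2) * (2 * a)^-1)) +
      beta * (- 2 * W * ((-1) ^+ (d (+) odd k.+1./2) * (2 * a)^-1)) =
      (-1) ^+ (~~ (d (+) odd k.+1./2)) * t.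
    rewrite /t; case: d; case: (odd k./2); case: (odd k.+1./2) => /=;
      rewrite ?expr0 ?expr1; by field.
  rewrite sat_sign // /x -/d.
  by case: (d (+) _); rewrite /= ?expr0 ?expr1; field.
- by move=> k i; rewrite addn4 !xSS !opprK.
(* As x(0) and x(1) agree by computation, each shorter period equates a nonzero value with its
   opposite: period 1 through v(1) = x(2), periods 2 and 3 through x(2) and x(3). *)
- case=> [|[|[|[|]]]] // _ per.
  + by have [_] := per 0%N root; rewrite xSS => /x_neq.
  + by have [] := per 0%N root; rewrite xSS => /x_neq.
  + by have [] := per 0%N root; rewrite xSS => /x_neq.
Qed.
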